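(* Let $(A_P^{\mathbb Z},T_P)$ be the Pacman level 2 cellular automaton. Then $(A_P^{\mathbb Z},T_P)$ is neither mean sensitive nor almost mean equicontinuous.
   Context: Let $A=\{\mathtt 0,\mathtt 1,\mathtt G,\mathtt K,\mathtt P,\mathtt D\}$ be an alphabet of six distinct symbols ($\mathtt 0$ empty space, $\mathtt 1$ empty door, $\mathtt G$ ghost, $\mathtt K$ keymaster ghost, $\mathtt P$ pacman, $\mathtt D$ door with ghost). $Tx_i$ denotes the $i$-th coordinate of $Tx$. The Pacman cellular automaton $T:A^{\mathbb Z}\to A^{\mathbb Z}$ is defined, for $x\in A^{\mathbb Z}$, $i\in\mathbb Z$, with $a=x_{i-1}$, $b=x_i$, $c=x_{i+1}$, by: - $Tx_i=\mathtt 0$ if $\big(a\in\{\mathtt 0,\mathtt G,\mathtt K\}$ and $[(b\in\{\mathtt 0,\mathtt G,\mathtt K\}$ and $c\in\{\mathtt 0,\mathtt 1,\mathtt P\})$ or $(b=\mathtt P$ and $c\notin\{\mathtt 1,\mathtt D\})]\big)$ or $\big(a\in\{\mathtt 1,\mathtt D\}$ and $[(b\in\{\mathtt 0,\mathtt K\}$ and $c\in\{\mathtt 0,\mathtt 1,\mathtt P\})$ or $(b=\mathtt P$ and $c\notin\{\mathtt 1,\mathtt D\})]\big)$; - $Tx_i=\mathtt 1$ if $b\in\{\mathtt 1,\mathtt D\}$ and $c\notin\{\mathtt K,\mathtt D\}$; - $Tx_i=\mathtt G$ if $(a\in\{\mathtt 0,\mathtt G,\mathtt K\}$, $b\in\{\mathtt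 0,\mathtt G,\mathtt K\}$, $c\in\{\mathtt G,\mathtt D\})$ or $(a\in\{\mathtt 1,\mathtt D\}$, $b\in\{\mathtt 0,\mathtt K\}$, $c=\mathtt D)$; - $Tx_i=\mathtt K$ if $\big(c=\mathtt K$ and $[(a\in\{\mathtt 0,\mathtt G,\mathtt K\}$ and $b\in\{\mathtt 0,\mathtt G,\mathtt K\})$ or $(a\in\{\mathtt 1,\mathtt D\}$ and $b\in\{\mathtt 0,\mathtt K\})]\big)$ or $(a=\mathtt P$, $b\notin\{\mathtt 1,\mathtt D\}$, $c\in\{\mathtt 1,\mathtt D\})$ or $(b=\mathtt P$ and $c\in\{\mathtt 1,\mathtt D\})$; - $Tx_i=\mathtt P$ if $\big(a\in\{\mathtt 1,\mathtt D\}$ and $[(b\in\{\mathtt 0,\mathtt K\}$ and $c=\mathtt G)$ or $b=\mathtt G]\big)$ or $(a=\mathtt P$ and $b,c\notin\{\mathtt 1,\mathtt D\})$; - $Tx_i=\mathtt D$ if $b\in\{\mathtt 1,\mathtt D\}$ and $c\in\{\mathtt K,\mathtt D\}$. Let $A_2=\{\mathtt 0,\mathtt c,\mathtt b\}$ (empty, cherry, banana; distinct symbols) and let $T_2:A_2^{\mathbb Z}\to A_2^{\mathbb Z}$ act coordinatewise by $\mathtt 0\mapsto\mathtt 0$, $\mathtt b\mapsto\mathtt c$, $\mathtt c\mapsto\mathtt b$. Let $A_P=A\times A_2$. For $x\in A_P^{\mathbb Z}$ write $x_i=(p_i,q_i)$ with $p\in A^{\mathbb Z}$, $q\in A_2^{\mathbb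 Z}$. The Pacman level 2 CA $T_P:A_P^{\mathbb Z}\to A_P^{\mathbb Z}$ is $T_Px_i=(Tp_i,\mathtt c)$ if $x_i\in\{(\mathtt K,\mathtt c),(\mathtt D,\mathtt c),(\mathtt G,\mathtt c)\}$, and $T_Px_i=(Tp_i,T_2q_i)$ otherwise. The metric on $A_P^{\mathbb Z}$ is $d(x,y)=2^{-i}$ with $i=\min\{|j|:x_j\ne y_j\}$ if $x\neq y$, and $d(x,x)=0$. For a system $(X,S)$: a point $x$ is a mean equicontinuity point if for every $\varepsilon>0$ there is $\delta>0$ such that $d(x,y)<\delta$ implies $\limsup_{n\to\infty}\frac{1}{n+1}\sum_{i=0}^{n}d(S^ix,S^iy)\le\varepsilon$; $(X,S)$ is almost mean equicontinuous if the set of mean equicontinuity points is residual (the intersection of countably many dense open sets); $(X,S)$ is mean sensitive if there is $\varepsilon>0$ such that for every non-empty open $U\subseteq X$ there exist $x,y\in U$ with $\limsup_{n\to\infty}\frac{1}{n+1}\sum_{i=0}^{n}d(S^ix,S^iy)>\varepsilon$. *)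

(* Defs.v *)
From HB Require Import structures.
From mathcomp Require Import all_boot all_order all_algebra.
From mathcomp Require Import all_classical all_reals all_analysis.

Set Implicit Arguments.
Unset Strict Implicit.
Unset Printing Implicit Defensive.

Import Order.TTheory GRing.Theory Num.Theory.
Local Open Scope classical_set_scope.
Local Open Scope ring_scope.

Section mean_dynamics.
Context {R : realType} {X : metricType R}.
Implicit Types (S : X -> X) (x y : X).

(* The limit superior is taken in \bar R, where it is meaningful for every
   sequence, bounded or not. *)
Definition mean_dist S x y : \bar R :=
  limn_esup (fun n : nat =>
    ((\sum_(i < n.+1) mdist (iter i S x) (iter i S y)) / n.+1%:R)%:E).

Definition mean_equicontinuity_point S x :=
  forall eps : R, 0 < eps ->
    exists2 delta : R, 0 < delta &
      forall y, mdist x y < delta -> (mean_dist S x y <= eps%:E)%E.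

(* The set of mean equicontinuity points of any map is a G_delta, so asking
   only for inclusion of the intersection would give the same notion of almost
   mean equicontinuity. *)
Definition residual (E : set X) :=
  exists F : nat -> set X,
    (forall n, open (F n) /\ dense (F n)) /\ E = \bigcap_n F n.

Definition almost_mean_equicontinuous S :=
  residual [set x | mean_equicontinuity_point S x].

Definition mean_sensitive S :=
  exists2 eps : R, 0 < eps &
    forall U : set X, open U -> U !=set0 ->
      exists x y, [/\ U x, U y & (eps%:E < mean_dist S x y)%E].

End mean_dynamics.

(* R only serves as the codomain of the metric. *)
Definition shift_space (R : realType) (A : choiceType) : Type := int -> A.

Section shift_metric.
Context {R : realType} {A : choiceType}.
Implicit Types x y z : shift_space R A.

HB.instance Definition _ := Choice.copy (shift_space R A) (int -> A).

Definition differ_at x y : pred nat :=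
  fun k => `[< exists2 j : int, `|j|%N = k & x j <> y j >].

Lemma neq_differ_at x y : x <> y -> exists k, differ_at x y k.
Proof.
move=> xy; apply: contrapT => h; apply: xy; apply/funext => j.
apply: contrapT => xyj; apply: h; exists `|j|%N; apply/asboolP.
by exists j.
Qed.

Definition shift_dist x y : R :=
  match pselect (x = y) with
  | left _ => 0
  | right xy => 2 ^- ex_minn (neq_differ_at xy)
  end.

Lemma shift_distxx x : shift_dist x x = 0.
Proof. by rewrite /shift_dist; case: pselect. Qed.

Lemma shift_dist_positivity x y : shift_dist x y = 0 -> x = y.
Proof.
rewrite /shift_dist; case: pselect => // xy /eqP.
by rewrite gt_eqF// invr_gt0 exprn_gt0.
Qed.

Lemma shift_dist_ge0 x y : 0 <= shift_dist x y.
Proof.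
by rewrite /shift_dist; case: pselect => // xy; rewrite invr_ge0 exprn_ge0.
Qed.

Lemma shift_dist_lb x y (j : int) : x j <> y j -> 2 ^- `|j|%N <= shift_dist x y.
Proof.
move=> xyj; rewrite /shift_dist; case: pselect => [xy|xy].
  by rewrite xy in xyj.
case: ex_minnP => m _ /(_ `|j|%N) mj.
rewrite lef_pV2 ?posrE ?exprn_gt0// ler_weXn2l ?ler1n// mj//.
by apply/asboolP; exists j.
Qed.

Lemma shift_dist_attained x y : x <> y ->
  exists2 j : int, x j <> y j & shift_dist x y = 2 ^- `|j|%N.
Proof.
move=> xy; rewrite /shift_dist; case: pselect => // xy'.
by case: ex_minnP => m /asboolP[j <- xyj] _; exists j.
Qed.

Lemma shift_dist_sym x y : shift_dist x y = shift_dist y x.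
Proof.
have h u v : shift_dist u v <= shift_dist v u.
  have [->//|/shift_dist_attained[j uvj ->]] := pselect (u = v).
  by apply: shift_dist_lb; apply/nesym.
by apply/eqP; rewrite eq_le !h.
Qed.

Lemma shift_dist_triangle y x z :
  shift_dist x z <= shift_dist x y + shift_dist y z.
Proof.
have [->|/shift_dist_attained[j xzj ->]] := pselect (x = z).
  by rewrite shift_distxx addr_ge0 ?shift_dist_ge0.
have [xyj|xyj] := pselect (x j = y j).
  by rewrite ler_wpDl ?shift_dist_ge0// shift_dist_lb// -xyj.
by rewrite ler_wpDr ?shift_dist_ge0// shift_dist_lb.
Qed.

HB.instance Definition _ := isMetric.Build R (shift_space R A)
  shift_distxx shift_dist_positivity shift_dist_sym shift_dist_triangle.

End shift_metric.

(* The symbols 0, 1, G, K, P, D, in this order. *)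
Inductive pacman_letter :=
  Empty | Door | Ghost | Keymaster | Pacman | DoorGhost.

Definition ord_of_pacman_letter (a : pacman_letter) : 'I_6 :=
  match a with
  | Empty => @Ordinal 6 0 isT | Door => @Ordinal 6 1 isT
  | Ghost => @Ordinal 6 2 isT | Keymaster => @Ordinal 6 3 isT
  | Pacman => @Ordinal 6 4 isT | DoorGhost => @Ordinal 6 5 isT
  end.

Definition pacman_letter_of_ord (i : 'I_6) : pacman_letter :=
  nth Empty [:: Empty; Door; Ghost; Keymaster; Pacman; DoorGhost] i.

Lemma ord_of_pacman_letterK : cancel ord_of_pacman_letter pacman_letter_of_ord.
Proof. by case. Qed.

HB.instance Definition _ :=
  Finite.copy pacman_letter (can_type ord_of_pacman_letterK).

(* The symbols 0, c, b, in this order. *)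
Inductive fruit := NoFruit | Cherry | Banana.

Definition ord_of_fruit (a : fruit) : 'I_3 :=
  match a with
  | NoFruit => @Ordinal 3 0 isT
  | Cherry => @Ordinal 3 1 isT
  | Banana => @Ordinal 3 2 isT
  end.

Definition fruit_of_ord (i : 'I_3) : fruit :=
  nth NoFruit [:: NoFruit; Cherry; Banana] i.

Lemma ord_of_fruitK : cancel ord_of_fruit fruit_of_ord.
Proof. by case. Qed.

HB.instance Definition _ := Finite.copy fruit (can_type ord_of_fruitK).

Section pacman_rule.
Variables a b c : pacman_letter.

Let room : seq pacman_letter := [:: Empty; Ghost; Keymaster].
Let doors : seq pacman_letter := [:: Door; DoorGhost].

Definition becomes_empty : bool :=
  (a \in room) &&
    ((b \in room) && (c \in [:: Empty; Door; Pacman])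
     || (b == Pacman) && (c \notin doors))
  || (a \in doors) &&
    ((b \in [:: Empty; Keymaster]) && (c \in [:: Empty; Door; Pacman])
     || (b == Pacman) && (c \notin doors)).

Definition becomes_door : bool :=
  (b \in doors) && (c \notin [:: Keymaster; DoorGhost]).

Definition becomes_ghost : bool :=
  [&& a \in room, b \in room & c \in [:: Ghost; DoorGhost]]
  || [&& a \in doors, b \in [:: Empty; Keymaster] & c == DoorGhost].

Definition becomes_keymaster : bool :=
  [|| (c == Keymaster) &&
        ((a \in room) && (b \in room)
         || (a \in doors) && (b \in [:: Empty; Keymaster])),
      [&& a == Pacman, b \notin doors & c \in doors]
    | (b == Pacman) && (c \in doors)].

Definition becomes_pacman : bool :=
  (a \in doors) &&
    ((b \in [:: Empty; Keymaster]) && (c == Ghost) || (b == Ghost))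
  || [&& a == Pacman, b \notin doors & c \notin doors].

Definition becomes_door_ghost : bool :=
  (b \in doors) && (c \in [:: Keymaster; DoorGhost]).

Definition pacman_rule : pacman_letter :=
  if becomes_empty then Empty
  else if becomes_door then Door
  else if becomes_ghost then Ghost
  else if becomes_keymaster then Keymaster
  else if becomes_pacman then Pacman
  else DoorGhost.

End pacman_rule.

(* The six conditions are exhaustive and mutually exclusive, so the order of
   the tests in pacman_rule is irrelevant. *)
Lemma pacman_ruleE (a b c : pacman_letter) :
  [/\ (pacman_rule a b c == Empty) = becomes_empty a b c,
      (pacman_rule a b c == Door) = becomes_door b c &
      (pacman_rule a b c == Ghost) = becomes_ghost a b c] /\
  [/\ (pacman_rule a b c == Keymaster) = becomes_keymaster a b c,
      (pacman_rule a b c == Pacman) = becomes_pacman a b c &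
      (pacman_rule a b c == DoorGhost) = becomes_door_ghost b c].
Proof.
by case: a; case: b; case: c.
Qed.

Definition pacman (p : int -> pacman_letter) : int -> pacman_letter :=
  fun i => pacman_rule (p (i - 1)) (p i) (p (i + 1)).

Definition fruit_swap (a : fruit) : fruit :=
  match a with NoFruit => NoFruit | Banana => Cherry | Cherry => Banana end.

Definition fruit_map (q : int -> fruit) : int -> fruit :=
  fun i => fruit_swap (q i).

Definition pacman2_letter : choiceType := (pacman_letter * fruit)%type.

Definition pacman_level2 {R : realType} (x : shift_space R pacman2_letter) :
    shift_space R pacman2_letter :=
  let p := fun i => (x i).1 in
  let q := fun i => (x i).2 in
  fun i =>
    if x i \in [:: (Keymaster, Cherry); (DoorGhost, Cherry); (Ghost, Cherry)]
    then (pacman p i, Cherry)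
    else (pacman p i, fruit_map q i).

(* Main.v *)
(** Doors never move, and a door sees only what lies on its right. Information
    therefore crosses a door leftwards only, carried by ghosts.

    Not mean sensitive: in a room, everything behind (to the left of) a
    keymaster or a pacman is empty, and a ghost must be turned into a pacman,
    walk to the right door, become a keymaster and walk back before the room
    emits anything. So an initially empty room of length [L] emits at most one
    ghost every [L] steps. Place such a room to the right of a window made of
    doors without fruit: the window differs from its rest state with frequency
    O(1/L).

    Not almost mean equicontinuous: let the cell 0 of [x] be a door with a
    cherry, and replace [x] beyond [N] by doors containing one ghost, at
    distance [k]. If [k] is large, all the rooms between 0 and [N] are empty
    when that ghost arrives (ghosts, then pacmans, then keymasters disappear),
    so it reaches the cell 0 at time [k + tau], with [tau] independent of [k],
    and is the last one to do so. It resets the parity of the fruit there,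
    hence the choices [k] and [k + 1] give points that are eventually at
    distance 1, and [x] is not a mean equicontinuity point. By the Baire
    argument, a residual set meets every cylinder. *)

Require Import Defs.
From mathcomp Require Import all_boot all_order all_algebra.
From mathcomp Require Import all_classical all_reals all_analysis.
From mathcomp Require Import zify lra.
(* [Empty] is also the name of a structure of classical_sets. *)
Import Defs.

Set Implicit Arguments.
Unset Strict Implicit.
Unset Printing Implicit Defensive.
Import Order.TTheory GRing.Theory Num.Theory.

(** * The local rule, and orbits on a half-line bounded by a door *)

Definition is_door (a : pacman_letter) := a \in [:: Door; DoorGhost].

Lemma is_door_rule a b c : is_door (pacman_rule a b c) = is_door b.
Proof. by case: a; case: b; case: c. Qed.

Lemma pacman_rule_doorghost a b c : is_door b ->
  (pacman_rule a b c == DoorGhost) = (c \in [:: Keymaster; DoorGhost]).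
Proof. by case: a; case: b; case: c. Qed.

Lemma pacman_rule_ghost a b c :
  pacman_rule a b c = Ghost -> c = Ghost \/ c = DoorGhost.
Proof. by case: a; case: b; case: c; auto. Qed.

Lemma pacman_rule_pacman a b c : pacman_rule a b c = Pacman ->
  (a = Pacman /\ ~~ is_door c) \/ (is_door a /\ (b = Ghost \/ c = Ghost)).
Proof. by case: a; case: b; case: c; auto. Qed.

Lemma pacman_rule_keymaster a b c : pacman_rule a b c = Keymaster ->
  c = Keymaster \/ (is_door c /\ (a = Pacman \/ b = Pacman)).
Proof. by case: a; case: b; case: c; auto. Qed.

Lemma doorE a : is_door a -> a != DoorGhost -> a = Door.
Proof. by case: a. Qed.

(* Cell 0 is a door, so it sees nothing of what lies on its left. *)
Definition half_line_orbit (w : nat -> nat -> pacman_letter) :=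
  [/\ forall t j, w t.+1 j.+1 = pacman_rule (w t j) (w t j.+1) (w t j.+2),
      forall t, is_door (w t 0) &
      forall t, (w t.+1 0 == DoorGhost) = (w t 1 \in [:: Keymaster; DoorGhost])].

Lemma half_line_is_door w t j : half_line_orbit w ->
  is_door (w t j) = is_door (w 0 j).
Proof.
move=> [wS w0 _]; case: j => [|j]; first by rewrite !w0.
by elim: t => // t IH; rewrite wS is_door_rule.
Qed.

Lemma half_line_doorghost w t j : half_line_orbit w -> is_door (w 0 j) ->
  (w t.+1 j == DoorGhost) = (w t j.+1 \in [:: Keymaster; DoorGhost]).
Proof.
move=> hw; have [wS _ w0] := hw; case: j => // j dj.
by rewrite wS pacman_rule_doorghost // half_line_is_door.
Qed.

Lemma half_line_shift w s d : half_line_orbit w -> is_door (w 0 d) ->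
  half_line_orbit (fun t j => w (s + t) (d + j)).
Proof.
move=> hw dd; have [wS _ _] := hw.
split=> [t j|t|t]; first by rewrite addnS !addnS wS.
  by rewrite addn0 half_line_is_door.
by rewrite addn0 addnS half_line_doorghost // addn1.
Qed.

(** * Clearing of a room that receives nothing *)

Definition is_room (L : nat) (w : nat -> nat -> pacman_letter) :=
  [/\ half_line_orbit w, forall t j, 0 < j <= L -> ~~ is_door (w t j) &
      forall t, is_door (w t L.+1)].

Lemma is_room_shift s L w : is_room L w -> is_room L (fun t j => w (s + t) j).
Proof.
move=> [hw wr wd]; split=> [|t j|t]; [|exact: wr|exact: wd].
by apply: (@half_line_shift w s 0) => //; case: hw.
Qed.

Section clearing.
Variables (L T : nat) (w : nat -> nat -> pacman_letter).
Hypotheses (hw : is_room L w) (no_input : forall t, t < T -> w t L.+1 = Door).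

(** A ghost comes from a ghost one cell to its right or from a ghost in the right door. Traced back
    along constant [t + j], it would have to enter through the silent right door. *)
Lemma no_ghost t j : t <= T -> 0 < j <= L -> L < t + j -> w t j <> Ghost.
Proof.
have [[wS w0 _] wr wd] := hw.
elim: t j => [|t IH] [//|j] tT jL; first by lia.
move=> Ltj; rewrite wS => /pacman_rule_ghost.
have [jL'|jL'] := ltnP j.+1 L; last first.
  have -> : j.+2 = L.+1 by lia.
  by rewrite no_input //; case.
case; first by apply: IH; lia.
by move=> e; have := wr t j.+2; rewrite e jL' => /(_ isT).
Qed.

(** From time [L] on no ghost is left to turn into a pacman, so a pacman comes from its left
    neighbour and is traced back to the left door. *)
Lemma no_pacman s j : L + s <= T -> 0 < j <= L -> j <= s ->
  w (L + s) j <> Pacman.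
Proof.
have [[wS w0 _] wr wd] := hw.
elim: s j => [|s IH] [//|j] sT jL js //.
rewrite addnS wS => /pacman_rule_pacman[[] e _|[_ []]].
- case: j jL js e => [|j] jL js e; first by have := w0 (L + s); rewrite e.
  by move: e; apply: IH; lia.
- by apply: no_ghost; lia.
- have [jL'|jL'] := ltnP j.+1 L; first by apply: no_ghost; lia.
  have -> : j.+2 = L.+1 by lia.
  by rewrite no_input //; lia.
Qed.

(** From time [L + L] on no pacman is left, so a keymaster comes from its right neighbour and is
    traced back to the right door. *)
Lemma no_keymaster s j : L + L + s <= T -> 0 < j <= L -> L < s + j ->
  w (L + L + s) j <> Keymaster.
Proof.
have [[wS w0 _] wr wd] := hw.
elim: s j => [|s IH] [//|j] sT jL js; first by lia.
have np i : 0 < i <= L -> w (L + L + s) i <> Pacman.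
  by move=> iL; rewrite -addnA; apply: no_pacman; lia.
rewrite addnS wS => /pacman_rule_keymaster[|[_ []]].
- have [jL'|jL'] := ltnP j.+1 L; first by apply: IH; lia.
  have -> : j.+2 = L.+1 by lia.
  by rewrite no_input //; lia.
- case: j jL js => [|j] jL js; last by apply: np; lia.
  by move=> e; have := w0 (L + L + s); rewrite e.
- exact: np.
Qed.

Lemma room_clears : L + L + L <= T ->
  forall j, 0 < j <= L -> w (L + L + L) j = Empty.
Proof.
move=> LT j jL; have [_ wr _] := hw.
have nd := wr (L + L + L) j jL.
have nG : w (L + L + L) j <> Ghost by apply: no_ghost; lia.
have nP : w (L + L + L) j <> Pacman by rewrite -addnA; apply: no_pacman; lia.
have nK : w (L + L + L) j <> Keymaster by apply: no_keymaster; lia.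
by case: (w _ j) nd nG nP nK.
Qed.

End clearing.

(** * Transit of a single ghost through an empty room *)

Definition room_holds L (w : nat -> nat -> pacman_letter) X i :=
  forall j, 0 < j <= L -> w 0 j = if j == i then X else Empty.

Definition closed_room L w :=
  [/\ is_room L w, forall t, w t L.+1 = Door & w 0 0 = Door].

Definition next_room (w : nat -> nat -> pacman_letter) t j := w t.+1 j.

Definition fires n (w : nat -> nat -> pacman_letter) :=
  forall t, (w t 0 == DoorGhost) = (t == n).

Lemma next_is_room L w : is_room L w -> is_room L (next_room w).
Proof. exact: (is_room_shift 1). Qed.

Lemma fires_next n w : w 0 0 = Door -> fires n (next_room w) -> fires n.+1 w.
Proof. by move=> w0 f [|t]; [rewrite w0|rewrite -[w _]/(next_room w t) f]. Qed.

Lemma empty_room_step L w t : 0 < L -> is_room L w -> w t L.+1 = Door ->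
  (forall j, 0 < j <= L -> w t j = Empty) ->
  w t.+1 0 = Door /\ forall j, 0 < j <= L -> w t.+1 j = Empty.
Proof.
move=> L0 [[wS w0 wD] _ _] cl em; split.
  by apply: doorE; rewrite // wD em.
move=> [//|j] jL; rewrite wS (em j.+1 jL).
have -> : w t j.+2 = if j.+1 == L then Door else Empty.
  by case: eqP => [->//|?]; apply: em; lia.
have [->|j0] := posnP j; first by have := w0 t; case: (w t 0); case: ifP.
by rewrite em; [case: ifP|lia].
Qed.

Lemma empty_room_never_fires L w t : 0 < L -> is_room L w ->
  (forall t, w t L.+1 = Door) ->
  (forall j, 0 < j <= L -> w 0 j = Empty) -> w t.+1 0 = Door.
Proof.
move=> L0 hw cl em.
suff: w t.+1 0 = Door /\ forall j, 0 < j <= L -> w t.+1 j = Empty by case.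
by elim: t => [|t [_ IH]]; apply: (empty_room_step L0).
Qed.

Definition moves L X i X' i' :=
  forall w, closed_room L w -> room_holds L w X i ->
  room_holds L (next_room w) X' i' /\ w 1 0 = Door.

(** The firing time [n] is chosen before [w]: it depends on [L], [X] and [i] only, hence not on the
    date at which the ghost enters. *)
Definition transits L X i :=
  exists n, forall w, closed_room L w -> room_holds L w X i -> fires n w.

Lemma transits_moves L X i X' i' : moves L X i X' i' -> transits L X' i' ->
  transits L X i.
Proof.
move=> mv [n fn]; exists n.+1 => w cw Xw; have [X'w w10] := mv w cw Xw.
case: (cw) => hw cl w0; apply: fires_next => //; apply: fn => //.
by split; [exact: next_is_room|move=> t; exact: cl|exact: w10].
Qed.

(** Reduces a move to a cell-by-cell check of the local rule, for either state [d] of the left door.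
    A keymaster in cell 1 is excluded because it would put a ghost into that door. *)
Lemma moves_intro L X i X' i' : 0 < i <= L -> (X == Keymaster) ==> (1 < i) ->
  (forall j d, j < L -> is_door d ->
    pacman_rule (if j == 0 then d else if j == i then X else Empty)
      (if j.+1 == i then X else Empty)
      (if j.+1 == L then Door else if j.+2 == i then X else Empty) =
    (if j.+1 == i' then X' else Empty)) ->
  ~~ is_door X ->
  moves L X i X' i'.
Proof.
move=> iL hX hr nX w [[[wS w0 wD] _ _] cl w00] Xw; split; last first.
  apply: doorE; rewrite // wD Xw; last lia.
  case: eqP => // i1; move: hX nX; rewrite -i1.
  by case: (X).
move=> [//|j] jL; rewrite /next_room wS -(hr j (w 0 0) jL (w0 0)).
congr pacman_rule; last 1 first.
- by have [->//|jL'] := eqVneq j.+1 L; apply: Xw; lia.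
- by have [->//|j0] := eqVneq j 0; apply: Xw; lia.
- exact: Xw.
Qed.

Ltac moves_tac := apply: moves_intro => //; [lia..|];
  move=> j [] // ? ?; repeat (case: eqP => ? ); try lia; done.

Lemma moves_keymaster L i : 0 < i < L -> moves L Keymaster i.+1 Keymaster i.
Proof. by move=> iL; moves_tac. Qed.

Lemma moves_ghost L i : 1 < i < L -> moves L Ghost i.+1 Ghost i.
Proof. by move=> iL; moves_tac. Qed.

(** The rule turns a ghost in either of the two cells nearest to the left door into a pacman in cell
    1. The turn at the right door is symmetric. *)
Lemma moves_ghost_pacman L i : 0 < i <= L -> i <= 2 -> moves L Ghost i Pacman 1.
Proof. by move=> iL i2; moves_tac. Qed.

Lemma moves_pacman L i : 0 < i -> i.+1 < L -> moves L Pacman i Pacman i.+1.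
Proof. by move=> iL i2; moves_tac. Qed.

Lemma moves_pacman_keymaster L i : 0 < i <= L -> L <= i.+1 ->
  moves L Pacman i Keymaster L.
Proof. by move=> iL i2; moves_tac. Qed.

(** The keymaster puts a ghost into the left door at time 1 and leaves an empty room, which never
    fires again. *)
Lemma transits_keymaster1 L : 0 < L -> transits L Keymaster 1.
Proof.
move=> L0; exists 1 => w [hw cl w0] Kw.
have [[wS wd wD] _ _] := hw.
have em j : 0 < j <= L -> w 1 j = Empty.
  case: j => // j jL; rewrite wS (Kw j.+1) //.
  have -> : w 0 j.+2 = if j.+1 == L then Door else Empty.
    by case: eqP => [->//|?]; rewrite Kw //; lia.
  case: j jL => [|j] jL; first by rewrite w0 /=; case: ifP.
  by rewrite Kw; [case: eqP => // _; case: ifP|lia].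
case=> [|[|t]]; first by rewrite w0.
  by rewrite wD Kw //; lia.
suff -> : w t.+2 0 = Door by [].
apply: (@empty_room_never_fires L (next_room w) t L0 (next_is_room hw)) => // s.
exact: cl.
Qed.

Lemma transits_keymaster L i : 0 < i <= L -> transits L Keymaster i.
Proof.
elim: i => // -[_|i IH] iL; first by apply: transits_keymaster1; lia.
by apply: transits_moves (IH _); [apply: moves_keymaster|]; lia.
Qed.

Lemma transits_pacman L i : 0 < i <= L -> transits L Pacman i.
Proof.
(* Induction on the distance to the right door, towards which the pacman walks. *)
move=> iL; have [n le_n] := ubnP (L - i); elim: n => // n IH in i iL le_n *.
have [iL'|iL'] := ltnP i.+1 L; last first.
  by apply: transits_moves (@transits_keymaster L L _);
    [exact: moves_pacman_keymaster|lia].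
by apply: transits_moves (IH i.+1 _ _); [apply: moves_pacman|..]; lia.
Qed.

Lemma transits_ghost L i : 0 < i <= L -> transits L Ghost i.
Proof.
elim: i => // i IH iL; have [i1|i1] := leqP i 1.
  by apply: transits_moves (@transits_pacman L 1 _);
    [apply: moves_ghost_pacman|]; lia.
by apply: transits_moves (IH _); [apply: moves_ghost|]; lia.
Qed.

(** * Propagation of a late ghost through successive rooms *)

(** [k] indexes a family of orbits and is the delay of the late ghost. Times before [M] are left
    free, since older ghosts may still be on their way; [M] and [tau] are common to all [k]. *)
Definition pulse (W : nat -> nat -> nat -> pacman_letter) j :=
  exists M tau, forall k t, M <= k -> M <= t ->
    (W k t j == DoorGhost) = (t == k + tau).

Lemma pulse_room W L : 0 < L -> (forall k, is_room L (W k)) ->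
  pulse W L.+1 -> pulse W 0.
Proof.
move=> L0 hW [M [tau pM]].
have [n fn] : transits L Ghost L by apply: transits_ghost; lia.
(* The room clears within [L + L + L] steps after [M], and its left door one step later. The delay
   grows by one step to enter cell [L] and by [n] to cross. *)
exists (M + (L + L + L)).+1, (tau + 1 + n) => k t kM tM.
have [hw wr wd] := hW k; have [wS w0 wD] := hw.
set c := M + (L + L + L) in kM tM *.
have cl s : M <= s -> s != k + tau -> W k s L.+1 = Door.
  by move=> Ms st; apply: doorE; rewrite // pM //; [lia].
have em0 j : 0 < j <= L -> W k c j = Empty.
  apply: (room_clears (is_room_shift M (hW k)) (T := L + L + L)) => // s sL.
  by apply: cl; lia.
(* At time [c] itself the left door may still hold a ghost emitted just before, hence the
   alternative [s == 0]. *)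
have em s : c + s <= k + tau -> (s == 0) || (W k (c + s) 0 == Door) /\
    forall j, 0 < j <= L -> W k (c + s) j = Empty.
  elim: s => [_|s IH sk]; first by rewrite addn0.
  have [|_ e] := IH; first lia.
  rewrite addnS /=.
  have [] := empty_room_step (t := c + s) L0 (hW k) _ e; first by apply: cl; lia.
  by move=> ->.
have [|_ emk] := em (k + tau - c); first lia.
rewrite subnKC in emk; last lia.
have dk : W k (k + tau).+1 0 = Door.
  by apply: doorE; rewrite // wD emk.
have cr : closed_room L (fun t j => W k ((k + tau).+1 + t) j).
  split; [exact: is_room_shift|by move=> s; apply: cl; lia|by rewrite addn0].
have [tk|tk] := leqP t (k + tau).
  have [|+ _] := em (t - c); first lia.
  rewrite subnKC; last lia.
  case/orP => [|/eqP ->]; first lia.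
  by apply/esym/negbTE; lia.
have := fn _ cr _ (t - (k + tau).+1); rewrite subnKC // => ->; first by lia.
(* It remains to see that the ghost of the right door at time [k + tau] becomes a ghost in cell [L]
   of an otherwise empty room. *)
move=> [//|j] jL; rewrite addn0 wS (emk j.+1 jL).
have [e|ne] := eqVneq j.+1 L.
  rewrite e; have /eqP -> : W k (k + tau) L.+1 == DoorGhost by rewrite pM //; lia.
  have [j0|j0] := posnP j; last by rewrite emk //; lia.
  by rewrite j0; have := w0 (k + tau); case: (W _ _ 0).
rewrite (emk j.+2); last lia.
have [j0|j0] := posnP j; last by rewrite emk //; lia.
by rewrite j0; have := w0 (k + tau); case: (W _ _ 0).
Qed.

Lemma pulse_left W N : (forall k, half_line_orbit (W k)) ->
  (forall k j, is_door (W k 0 j) = is_door (W 0 0 j)) ->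
  is_door (W 0 0 N) -> pulse W N -> pulse W 0.
Proof.
move=> hW dW; elim/ltn_ind: N => -[|N] // IH dN pN.
pose doors_below := fun j => (j <= N) && is_door (W 0 0 j).
have ex : exists j, doors_below j.
  by exists 0; rewrite /doors_below; have [_ -> _] := hW 0.
(* [d] is the nearest door to the left of [N.+1]. By [dW] it is the same for all [k]. *)
have [d /andP[dN' dd] dmax] :=
  ex_maxnP ex (fun j (dj : doors_below j) => proj1 (andP dj)).
have hd k : half_line_orbit (fun t j => W k t (d + j)).
  by apply: (@half_line_shift _ 0) => //; rewrite dW.
suff: pulse W d by apply: IH.
(* Adjacent doors pass the ghost on in one step; otherwise a room of length [N - d] separates
   them. *)
have [dN''|dN''] := eqVneq d N.
  have [M [tau pM]] := pN; exists M.+1, tau.+1 => k [|t] // kM tM.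
  rewrite half_line_doorghost // ?dW // addnS eqSS -pM; [|lia..].
  have : is_door (W k t N.+1) by rewrite half_line_is_door // dW.
  by rewrite dN''; case: (W k t N.+1).
suff [M [tau pM]] : pulse (fun k t j => W k t (d + j)) 0.
  by exists M, tau => k t; rewrite -{1}[d]addn0; exact: pM.
apply: (@pulse_room _ (N - d)); first lia; last first.
  have e : d + (N - d).+1 = N.+1 by lia.
  by case: pN => M [tau pM]; exists M, tau => k t; rewrite e; exact: pM.
move=> k; split=> // [t j jL|t]; rewrite half_line_is_door // dW.
  apply/negP => dj; have := dmax (d + j); rewrite /doors_below dj; lia.
by have -> : d + (N - d).+1 = N.+1 by lia.
Qed.

(** * Gaps between the emissions of an initially empty room *)

Section outflow_gaps.
Variables (L : nat) (w : nat -> nat -> pacman_letter).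
Hypotheses (hw : is_room L w) (w_empty : forall j, 0 < j <= L -> w 0 j = Empty).

(** A pacman walks right and leaves its cell empty, unless the right door follows: there it may turn
    into a keymaster on the spot, hence the condition at [i = j]. *)
Lemma empty_behind_pacman t j :
  (forall i, 0 < i < j -> w t i = Empty) -> 0 < j <= L -> w t j = Pacman ->
  forall i, 0 < i <= j -> (i == j) ==> ~~ is_door (w t j.+1) ->
  w t.+1 i = Empty.
Proof.
have [[wS w0 _] _ _] := hw.
move=> em jL jP [//|i] ij hj; rewrite wS.
have ai : (i == 0) || (w t i == Empty).
  by have [//|i0] := posnP i; rewrite em ?eqxx //; lia.
have {}ai : is_door (w t i) || (w t i == Empty).
  by case/orP: ai => [/eqP ->|->]; rewrite ?w0 ?orbT.
have [e|ne] := eqVneq i.+1 j.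
  by move: hj ai; rewrite e eqxx jP; case: (w t i); case: (w t j.+1).
rewrite (em i.+1); last lia.
have [e|ne'] := eqVneq i.+2 j; first by rewrite e jP; case: (w t i) ai.
by rewrite (em i.+2); [case: (w t i) ai|lia].
Qed.

(** Induction on time: a keymaster descends from a keymaster or a pacman, and a pacman from a
    pacman, unless it is born from a ghost in cell 1, with nothing behind it. *)
Lemma empty_behind t i j : 0 < i < j -> j <= L ->
  w t j \in [:: Keymaster; Pacman] -> w t i = Empty.
Proof.
have [[wS w0 _] wr wd] := hw.
elim: t i j => [|t IH] i j ij jL; first by rewrite w_empty //; lia.
case: j ij jL => [|j] ij jL; first by lia.
have behind k : 0 < k <= L -> w t k = Pacman ->
    forall i, 0 < i < k -> w t i = Empty.
  by move=> kL e i' ik; apply: (IH _ k); rewrite ?e //; lia.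
have after_j : w t j = Pacman -> w t.+1 i = Empty.
  move=> e; have j0 : 0 < j by case: j e {ij jL} => // e; have := w0 t; rewrite e.
  apply: (empty_behind_pacman (j := j)); rewrite ?wr ?implybT //; try lia.
  by apply: behind => //; lia.
rewrite !inE => /orP[] /eqP; rewrite wS.
  case/pacman_rule_keymaster => [e|[_ [//|e]]]; last first.
    apply: (empty_behind_pacman (j := j.+1)) => //; [|lia..].
    exact: behind.
  have jL' : j.+1 < L.
    by rewrite ltn_neqAle jL andbT; apply/eqP => jL'; have := wd t; rewrite -jL' e.
  have em k : 0 < k <= j.+1 -> w t k = Empty.
    by move=> kj; apply: (IH _ j.+2); rewrite ?e //; lia.
  case: i ij after_j => // i ij _; rewrite wS (em i.+1) ?(em i.+2); [|lia..].
  have [->|i0] := posnP i; first by have := w0 t; case: (w t 0).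
  by rewrite em //; lia.
case/pacman_rule_pacman => [[? _]|[da _]]; first exact: after_j.
have [j0|j0] := posnP j; first by lia.
by have /negP[] : ~~ is_door (w t j) by apply: wr; lia.
Qed.

Lemma keymaster_gap t s : w t 1 = Keymaster -> 0 < s < L ->
  w (t + s) 1 <> Keymaster.
Proof.
move=> Kt sL; have [[wS w0 _] wr wd] := hw.
(* By [empty_behind], at time [t] no pacman or keymaster lies beyond cell 1. Later pacmans have
   walked at most to cell [s], too short to reach the right door, the only place where keymasters
   are created. *)
suff /(_ 1) : forall j, 0 < j <= L ->
    (w (t + s) j = Keymaster -> s = 0 /\ j = 1) /\
    (w (t + s) j = Pacman -> j <= s).
  by case=> [|K1 _]; [lia|move/K1 => []; lia].
have {sL} sL : s < L by lia.
elim: s sL => [|s IH] sL j jL.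
  rewrite addn0; have [->|j1] := eqVneq j 1; first by rewrite Kt.
  by split=> e; have := @empty_behind t 1 j; rewrite e Kt => /(_ _ _ isT) h;
    suff: Keymaster = Empty by []; apply: h; lia.
have {}IH := IH (ltnW sL).
case: j jL => // j jL; rewrite addnS wS; split.
  case/pacman_rule_keymaster => [e|[dj eP]].
    have jL' : j.+1 < L.
      rewrite ltn_neqAle; apply/andP; split; last by lia.
      by apply/eqP => jL'; have := wd (t + s); rewrite -jL' e.
    by have [|+ _] := IH j.+2; [lia|move=> /(_ e) []].
  have {dj} jL' : j.+1 = L.
    apply/eqP; rewrite eqn_leq; apply/andP; split; first lia.
    by rewrite leqNgt; apply/negP => jL'; move: dj; apply/negP/wr; lia.
  case: eP => e; last by have [|_ /(_ e)] := IH j.+1; lia.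
  have [j0|j0] := posnP j; first by have := w0 (t + s); rewrite -j0 e.
  by have [|_ /(_ e)] := IH j; lia.
case/pacman_rule_pacman => [[e _]|[dj _]].
  have [->//|j0] := posnP j.
  by have [|_ /(_ e)] := IH j; lia.
have [->//|j0] := posnP j.
by have /negP[] : ~~ is_door (w (t + s) j) by apply: wr; lia.
Qed.

End outflow_gaps.

(** * Counting the ghosts that cross a row of doors *)

Definition gapped L (Z : pred nat) :=
  forall t s, Z t -> 0 < s < L -> ~~ Z (t + s).

(** The hits reserve disjoint blocks of [L] times, and only the last block can reach beyond [n]. *)
Lemma count_gapped L (Z : pred nat) n : gapped L Z ->
  L * (\sum_(t < n) Z t) <= n + L.
Proof.
move=> gZ.
(* [e] is the first time at which Z may hold again. *)
suff [e [cZ _ eL]] : exists e, [/\ L * (\sum_(t < n) Z t) <= e,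
    forall t, n <= t < e -> ~~ Z t & e <= n + L] by exact: leq_trans cZ eL.
elim: n => [|n [e [cZ Ze eL]]].
  by exists 0; rewrite big_ord0 muln0; split => // t; lia.
rewrite big_ord_recr mulnDr /=; have [Zn|Zn] := boolP (Z n);
  rewrite /= ?muln1 ?muln0.
  have en : e <= n by rewrite leqNgt; apply/negP => en; move: Zn; apply/negP/Ze; lia.
  exists (n + L); split; [by rewrite leq_add2r (leq_trans cZ)| |lia].
  by move=> t tn; rewrite -(subnKC (_ : n <= t)); [apply: gZ|]; lia.
by exists e; split; [by rewrite addn0|move=> t tn; apply: Ze; lia|lia].
Qed.

Lemma doorghost_gapped w D L j : half_line_orbit w ->
  (forall i, i <= D -> w 0 i = Door) ->
  (forall i, 0 < i <= L -> w 0 (D + i) = Empty) -> is_door (w 0 (D + L.+1)) ->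
  0 < L -> j <= D -> gapped L (fun t => w t j == DoorGhost).
Proof.
(* Induction on the distance to door [D]: each door repeats its right neighbour one step later, and
   door [D] itself fires on a keymaster in the first cell of the room. *)
move=> hw dD eL dL L0 jD; rewrite -(subKn jD); move: (D - j) (leq_subr j D) => {jD}j.
have wdoor i : i <= D -> is_door (w 0 i) by move=> iD; rewrite dD.
elim: j => [_|j IH jD] [|t] s; rewrite ?subn0 ?dD ?leq_subr //; last first.
- move: (IH (ltnW jD) t s); rewrite addSn !half_line_doorghost ?wdoor ?leq_subr //.
  rewrite subnSK //; have : is_door (w t (D - j)).
    by rewrite half_line_is_door // wdoor // leq_subr.
  have : is_door (w (t + s) (D - j)).
    by rewrite half_line_is_door // wdoor // leq_subr.
  by case: (w t _); case: (w _ _).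
have hr : is_room L (fun t j => w (0 + t) (D + j)).
  split=> [|t' i iL|t']; first by apply: half_line_shift => //; rewrite dD.
    by rewrite add0n half_line_is_door // eL.
  by rewrite add0n half_line_is_door.
rewrite addSn !half_line_doorghost ?wdoor // => Kt sL.
have nD t' : w t' D.+1 != DoorGhost.
  apply/eqP => e; have [_ /(_ t' 1)] := hr.
  by rewrite add0n addn1 e => /(_ L0).
have := @keymaster_gap L _ hr eL t s; rewrite !add0n !addn1.
move: Kt (nD t); rewrite !inE => /orP[/eqP ->|->] // _ /(_ erefl sL) nK.
by rewrite (negPf (nD _)) orbF; apply/eqP.
Qed.

Local Open Scope classical_set_scope.
Local Open Scope ring_scope.

(** * Bounds on limits superior *)

Section limsup.
Context {R : realType}.
Implicit Type u : nat -> R.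

Lemma limn_esup_le u (N : nat) (e : R) : (forall n, (N <= n)%N -> u n <= e) ->
  (limn_esup (fun n => (u n)%:E) <= e%:E)%E.
Proof.
move=> ue; rewrite /limn_esup limf_esupE.
apply: (@le_trans _ _ (ereal_sup ((fun n => (u n)%:E) @` [set n | (N <= n)%N]))).
  by apply: ereal_inf_lbound => /=; exists [set n | (N <= n)%N] => //; exists N.
by apply: ge_ereal_sup => _ [n /= Nn <-]; rewrite lee_fin ue.
Qed.

Lemma lt_of_limn_esup u (e e' : R) : (limn_esup (fun n => (u n)%:E) <= e%:E)%E ->
  e < e' -> exists N, forall n, (N <= n)%N -> u n < e'.
Proof.
move=> ue ee'.
have : (limn_esup (fun n => (u n)%:E) < e'%:E)%E.
  by apply: le_lt_trans ue _; rewrite lte_fin.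
rewrite /limn_esup limf_esupE => /ereal_inf_lt[_ [A [N _ NA] <-] Ae'].
exists N => n Nn; rewrite -lte_fin; apply: le_lt_trans Ae'.
by apply: ereal_sup_ubound; exists n => //; apply: NA.
Qed.

End limsup.

(** * Cylinders and the Baire argument *)

Section cylinders.
Context {R : realType} {A : choiceType}.
Implicit Types (x y : shift_space R A) (N : nat).

Definition cylinder x N : set (shift_space R A) :=
  [set y | forall j : int, (`|j| <= N)%N -> x j = y j].

Lemma mdist_shiftE x y : mdist x y = shift_dist x y :> R.
Proof. by []. Qed.

Lemma cylinderP x N y : cylinder x N y <-> mdist x y < 2 ^- N :> R.
Proof.
rewrite mdist_shiftE; split=> [xy|xy j jN].
  have [->|/shift_dist_attained[j xyj ->]] := pselect (x = y).
    by rewrite shift_distxx invr_gt0 exprn_gt0.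
  rewrite ltf_pV2 ?posrE ?exprn_gt0 // ltr_eXn2l ?ltr1n // ltnNge.
  by apply/negP => /xy.
apply: contrapT => /(@shift_dist_lb R); apply/negP; rewrite -ltNge.
apply: lt_le_trans xy _; rewrite lef_pV2 ?posrE ?exprn_gt0 //.
by rewrite ler_eXn2l ?ltr1n.
Qed.

Lemma cylinder_sub_ball x (e : R) : 0 < e -> exists N, cylinder x N `<=` ball x e.
Proof.
move=> e0; have [N _ Ne] := near_infty_natSinv_expn_lt (PosNum e0).
exists N => y /cylinderP; rewrite ballEmdist /= => /lt_trans; apply.
by have := Ne N (leqnn N); rewrite /= div1r.
Qed.

Lemma open_cylinder x N : open (cylinder x N).
Proof.
rewrite openE => y xy; rewrite /interior; apply/nbhs_ballP.
exists (2 ^- N) => /=; first by rewrite invr_gt0 exprn_gt0.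
move=> z; rewrite ballEmdist /= => /cylinderP yz j jN.
by rewrite xy // yz.
Qed.

Lemma open_sub_cylinder (U : set (shift_space R A)) x : open U -> U x ->
  exists N, cylinder x N `<=` U.
Proof.
rewrite openE => oU /oU; rewrite /interior => /nbhs_ballP[e /= e0 eU].
have [N Ne] := cylinder_sub_ball x e0; exists N.
exact: subset_trans eU.
Qed.

Lemma residual_meets_cylinder (E : set (shift_space R A)) x N : residual E ->
  (E `&` cylinder x N) !=set0.
Proof.
move=> [F [oF ->]].
(* One Baire step: shrink the current cylinder into the next dense open set, with a strictly larger
   radius. *)
have step (p : nat * (shift_space R A * nat)) : exists c : shift_space R A * nat,
    [/\ (p.2.2 < c.2)%N, cylinder p.2.1 p.2.2 c.1 & cylinder c.1 c.2 `<=` F p.1].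
  case: p => n [z M] /=; have [oFn dFn] := oF n.
  have [||y [zy Fy]] := dFn (cylinder z M); first by exists z.
    exact: open_cylinder.
  have [K KF] := open_sub_cylinder oFn Fy.
  exists (y, maxn K M.+1); split=> //=; first by rewrite leq_max leqnn orbT.
  by apply: subset_trans KF => u yu j jK; apply: yu; rewrite leq_max jK.
have [f fP] := choice step.
pose c := fix c n := if n is n'.+1 then f (n', c n') else (x, N).
have cP n : [/\ ((c n).2 < (c n.+1).2)%N, cylinder (c n).1 (c n).2 (c n.+1).1
    & cylinder (c n.+1).1 (c n.+1).2 `<=` F n] by exact: fP (n, c n).
have c_ge n : (n <= (c n).2)%N.
  by elim: n => // n IH; have [+ _ _] := cP n; exact: leq_ltn_trans.
have c_mono n k : ((c n).2 <= (c (n + k)%N).2)%N.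
  elim: k => [|k IH]; rewrite ?addn0 // addnS; have [h _ _] := cP (n + k)%N.
  by apply: leq_trans IH (ltnW h).
have c_cyl n k : cylinder (c n).1 (c n).2 (c (n + k)%N).1.
  elim: k => [|k IH]; rewrite ?addn0 // addnS => j jn.
  have [_ h _] := cP (n + k)%N.
  by rewrite IH // h // (leq_trans jn).
(* The radius at stage [n] is at least [n], so cell [j] is frozen from stage [|j|] on and can be
   read off there. *)
pose y : shift_space R A := fun j => (c `|j|%N).1 j.
have yP n : cylinder (c n).1 (c n).2 y.
  move=> j jn; rewrite (c_cyl n `|j|%N) // addnC; symmetry.
  by apply: c_cyl; exact: c_ge.
exists y; split; last exact: yP 0%N.
by move=> n _; have [_ _] := cP n; apply; exact: yP.
Qed.

End cylinders.

(** * Orbits of the level 2 automaton *)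

Section orbits.
Context {R : realType}.
Implicit Types x y : shift_space R pacman2_letter.
Local Notation TP := (@pacman_level2 R).

Lemma pacman_level2_fst x i :
  (TP x i).1 = pacman_rule (x (i - 1)).1 (x i).1 (x (i + 1)).1.
Proof. by rewrite /pacman_level2; case: ifP. Qed.

Lemma pacman_level2_snd x i : (TP x i).2 =
  if ((x i).1 \in [:: Keymaster; DoorGhost; Ghost]) && ((x i).2 == Cherry)
  then Cherry else fruit_swap (x i).2.
Proof.
by rewrite /pacman_level2 /fruit_map; case: (x i) => [p q]; case: p; case: q.
Qed.

Definition cells_from x (d : int) t j := (iter t TP x (d + j%:Z)).1.

Lemma cells_from_orbit x d : is_door (x d).1 -> half_line_orbit (cells_from x d).
Proof.
move=> dd.
have w0 t : is_door (cells_from x d t 0).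
  rewrite /cells_from addr0; elim: t => //= t IH.
  by rewrite pacman_level2_fst is_door_rule.
split=> // [t j|t]; rewrite /cells_from /= pacman_level2_fst.
  by congr pacman_rule; congr (iter _ _ _ _).1; lia.
by rewrite addr0 pacman_rule_doorghost // -[d]addr0; exact: w0.
Qed.

Lemma no_fruit_persists x i t : (x i).2 = NoFruit -> (iter t TP x i).2 = NoFruit.
Proof.
by move=> xi; elim: t => //= t IH; rewrite pacman_level2_snd IH andbF.
Qed.

Lemma fruit_persists x i t : (x i).2 != NoFruit -> (iter t TP x i).2 != NoFruit.
Proof.
move=> xi; elim: t => //= t; rewrite pacman_level2_snd.
by case: ifP => // _; case: (_.2).
Qed.

Lemma mdist_le1 x y : mdist x y <= 1 :> R.
Proof.
rewrite mdist_shiftE; have [->|/shift_dist_attained[j _ ->]] := pselect (x = y).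
  by rewrite shift_distxx.
by rewrite invf_le1 ?exprn_gt0 // exprn_ege1 // ler1n.
Qed.

Lemma mdist_eq1 x y : x 0 <> y 0 -> mdist x y = 1 :> R.
Proof.
move=> xy; apply/eqP; rewrite eq_le mdist_le1 /= mdist_shiftE.
by have := shift_dist_lb (R := R) xy; rewrite expr0 invr1.
Qed.

(** * Failure of mean sensitivity *)

(** The room lies between the doors [m.+1] and [(m + L).+2], so the cylinder of radius [(m + L).+2]
    fixes it together with the window. *)
Definition room_point (m L : nat) : shift_space R pacman2_letter := fun i =>
  (if ((m.+1)%:Z < i) && (i <= (m.+1 + L)%:Z) then Empty else Door, NoFruit).

(** Orbits that agree on the window are within [2 ^- m]. Otherwise they differ at a door without
    fruit, so one of them has a ghost there and the sum is at least 1, the diameter. *)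
Lemma mdist_iter_room_point m L x y t :
  cylinder (room_point m L) (m + L).+2 x ->
  cylinder (room_point m L) (m + L).+2 y ->
  mdist (iter t TP x) (iter t TP y) <= 2 ^- m +
   (\sum_(i < (m + m).+1) ((cells_from x (- m%:Z) t i == DoorGhost) +
                      (cells_from y (- m%:Z) t i == DoorGhost)))%N%:R :> R.
Proof.
move=> Ux Uy.
have [/cylinderP/ltW h|] := pselect (cylinder (iter t TP x) m (iter t TP y)).
  by apply: le_trans h _; rewrite lerDl ler0n.
rewrite /cylinder /= => /existsNP[j /not_implyP[jm xyj]].
apply: (le_trans (mdist_le1 _ _)); rewrite ler_wpDl ?invr_ge0 ?exprn_ge0 //.
have im : (absz (j + m%:Z)%R < (m + m).+1)%N by lia.
rewrite (ler_nat R 1) (bigD1 (Ordinal im)) //= ltn_addr //.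
have e : - m%:Z + (absz (j + m%:Z))%:Z = j by lia.
rewrite /cells_from e.
have nf z : cylinder (room_point m L) (m + L).+2 z -> (iter t TP z j).2 = NoFruit.
  by move=> Uz; apply: no_fruit_persists; rewrite -Uz //; lia.
have dr z : cylinder (room_point m L) (m + L).+2 z -> is_door (iter t TP z j).1.
  move=> Uz; have Uzj k : (`|k| <= m)%N -> (z k).1 = Door.
    by move=> km; rewrite -Uz /room_point /=; [case: ifP => //|]; lia.
  have /half_line_is_door : half_line_orbit (cells_from z (- m%:Z)).
    by apply: cells_from_orbit; rewrite Uzj //; lia.
  move=> /(_ t (absz (j + m%:Z))); rewrite /cells_from e => ->.
  by rewrite /= Uzj //; lia.
move: xyj (nf x Ux) (nf y Uy) (dr x Ux) (dr y Uy).
case: (iter t TP x j) => [p q]; case: (iter t TP y j) => [p' q'] /= + qN qN'.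
by rewrite qN qN'; case: p; case: p'.
Qed.

Lemma not_mean_sensitive : ~ mean_sensitive TP.
Proof.
move=> [eps eps0 sens].
have e2 : 0 < eps / 2 by rewrite divr_gt0.
have [m _ /(_ m (leqnn m)) me] := near_infty_natSinv_expn_lt (PosNum e2).
rewrite /= div1r in me.
(* For [n >= L] each cell of each point holds at most [2 * n.+1 / L] ghosts up to time [n]. Over two
   points and [(m + m).+1] cells the average is at most [4 * (m + m).+1 / L], which must not exceed
   [eps / 2]. *)
pose L := (Num.truncn ((8 * (m + m).+1)%:R / eps)).+1.
have Leps : (8 * (m + m).+1)%:R / eps < L%:R by exact: truncnS_gt.
have [||x [y [Ux Uy]]] := sens (cylinder (room_point m L) (m + L).+2).
- exact: open_cylinder.
- by exists (room_point m L).
apply/negP; rewrite -leNgt /mean_dist; apply: (@limn_esup_le _ _ L) => n Ln.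
rewrite ler_pdivrMr ?ltr0Sn //.
pose Z z i t := cells_from z (- m%:Z) t i == DoorGhost.
have gZ z i : cylinder (room_point m L) (m + L).+2 z -> (i < (m + m).+1)%N ->
    (L * (\sum_(t < n.+1) Z z i t) <= n.+1 + L)%N.
  move=> Uz im; apply: count_gapped.
  have Uzj (k : nat) : (k <= (m + m + L).+2)%N ->
      cells_from z (- m%:Z) 0 k = (room_point m L (- m%:Z + k%:Z)).1.
    by move=> km; rewrite /cells_from /= -Uz //; lia.
  apply: (@doorghost_gapped _ (m + m).+1 L); last by lia.
  - apply: cells_from_orbit; rewrite -Uz; last lia.
    by rewrite /room_point /=; case: ifP => //; lia.
  - by move=> k km; rewrite Uzj /room_point /=; [case: ifP => //|]; lia.
  - by move=> k km; rewrite Uzj /room_point /=; [case: ifP => //|]; lia.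
  - by rewrite Uzj /room_point /=; [case: ifP => //|]; lia.
  - by [].
pose S := (\sum_(t < n.+1) \sum_(i < (m + m).+1) (Z x i t + Z y i t))%N.
have SL : (L * S <= 4 * (m + m).+1 * n.+1)%N.
  rewrite /S exchange_big big_distrr /=.
  apply: (@leq_trans (\sum_(i < (m + m).+1) 4 * n.+1)%N).
    apply: leq_sum => i _; rewrite big_split mulnDr /=.
    apply: leq_trans (leq_add (gZ x i Ux (ltn_ord i)) (gZ y i Uy (ltn_ord i))) _.
    lia.
  by rewrite sum_nat_const card_ord; lia.
apply: (@le_trans _ _ (\sum_(t < n.+1) (2 ^- m +
    (\sum_(i < (m + m).+1) (Z x i t + Z y i t))%N%:R))).
  by apply: ler_sum => t _; exact: mdist_iter_room_point Ux Uy.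
rewrite big_split /= sumr_const card_ord -natr_sum -/S -(mulr_natr (2 ^- m)).
have L0 : 0 < L%:R :> R by rewrite ltr0n.
have : S%:R <= eps / 2 * n.+1%:R.
  rewrite -(ler_pM2l L0) -natrM.
  have : (L * S)%:R <= (4 * (m + m).+1 * n.+1)%:R :> R by rewrite ler_nat.
  move=> /le_trans; apply.
  rewrite natrM mulrA ler_pM2r ?ltr0Sn //.
  move: Leps; rewrite ltr_pdivrMr // !natrM => /ltW; lra.
have : 2 ^- m * n.+1%:R <= eps / 2 * n.+1%:R.
  by rewrite ler_pM2r ?ltr0Sn // ltW.
lra.
Qed.

(** * Failure of almost mean equicontinuity *)

(* The ghost reaches the cell [N + 1] at time [k]. *)
Definition late_ghost x (N k : nat) : shift_space R pacman2_letter := fun i =>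
  if i <= N%:Z then x i
  else (if i == (N.+1 + k)%:Z then DoorGhost else Door, NoFruit).

Lemma cylinder_late_ghost x N k : cylinder x N (late_ghost x N k).
Proof. by move=> j jN; rewrite /late_ghost; case: ifP => //; lia. Qed.

Lemma late_ghost_pulse x N : is_door (x 0).1 ->
  pulse (fun k => cells_from (late_ghost x N k) 0) 0.
Proof.
move=> x0.
have c0 k j : cells_from (late_ghost x N k) 0 0 j =
    if (j <= N)%N then (x j%:Z).1
    else if j == (N.+1 + k)%N then DoorGhost else Door.
  by rewrite /cells_from /= add0r /late_ghost lez_nat eqz_nat; case: ifP.
have hW k : half_line_orbit (cells_from (late_ghost x N k) 0).
  by apply: cells_from_orbit; rewrite /late_ghost.
have dr k j : (N < j)%N -> is_door (cells_from (late_ghost x N k) 0 0 j).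
  by move=> Nj; rewrite c0 leqNgt Nj; case: ifP.
apply: (@pulse_left _ N.+1) => //; last 2 first.
- exact: dr.
- exists 0%N, 0%N => k t _ _; rewrite addn0.
  (* Beyond [N] there are only doors, along which the ghost moves left one cell per step. *)
  suff : forall j, (cells_from (late_ghost x N k) 0 t (N.+1 + j) == DoorGhost) =
      (t + j == k)%N by move=> /(_ 0%N); rewrite !addn0.
  elim: t => [|t IH] j.
    by rewrite c0 ifF ?eqn_add2l ?add0n; [case: (j == k)|lia].
  rewrite half_line_doorghost //; last by apply: dr; lia.
  rewrite -addnS (addSnnS t) -IH;
  have : is_door (cells_from (late_ghost x N k) 0 t (N.+1 + j.+1)).
    by rewrite half_line_is_door //; apply: dr; lia.
  by case: (cells_from _ _ _ _).
- move=> k j; rewrite !c0; case: ifP => // _.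
  by case: ifP; case: ifP.
Qed.

Lemma iter_fruit_swapS s : iter s.+1 fruit_swap Cherry <> iter s fruit_swap Cherry.
Proof.
suff : iter s fruit_swap Cherry = if odd s then Banana else Cherry.
  by move=> /= ->; case: ifP.
by elim: s => //= s ->; case: (odd s).
Qed.

(** A ghost in the door yields a cherry from either fruit, which erases the past; with no further
    ghost the fruit then alternates. *)
Lemma fruit_after_ghost x (s : nat) : (x 0).2 != NoFruit -> is_door (x 0).1 ->
  (forall t, (s <= t)%N -> (cells_from x 0 t 0 == DoorGhost) = (t == s)) ->
  forall t, (iter (s.+1 + t) TP x 0).2 = iter t fruit_swap Cherry.
Proof.
move=> q0 p0 ds; have hw := cells_from_orbit p0.
elim=> [|t IH].
  rewrite addn0 /= pacman_level2_snd.
  have := ds s (leqnn s); rewrite eqxx /cells_from addr0 => /eqP ->.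
  by have := fruit_persists s q0; case: (_.2).
rewrite addnS /= pacman_level2_snd IH.
have := half_line_is_door (s.+1 + t) 0 hw; have := ds (s.+1 + t)%N.
have -> : (s.+1 + t == s)%N = false by lia.
move=> /(_ _)/negbT; rewrite /cells_from addr0 /= p0 => h dd.
by rewrite (doorE dd) //; apply: h; lia.
Qed.

Lemma not_mean_equicontinuity_point x : (x 0).1 = Door -> (x 0).2 = Cherry ->
  ~ mean_equicontinuity_point TP x.
Proof.
move=> p0 q0 /(_ (1 / 8)) [|delta delta0 mx]; first by rewrite divr_gt0.
have [N Nd] := cylinder_sub_ball x delta0.
have {Nd}mx k : (mean_dist TP x (late_ghost x N k) <= (1 / 8)%:E)%E.
  by apply: mx; have := Nd _ (@cylinder_late_ghost x N k); rewrite ballEmdist.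
have [|M [tau pM]] := @late_ghost_pulse x N; first by rewrite p0.
pose y := late_ghost x N M; pose z := late_ghost x N M.+1.
(* Time at which the later of the two ghosts, that of [z], has just reset the fruit; from then on
   the fruits of [y] and [z] are in opposite phases. *)
pose c := (M + tau).+2.
have far t : (c <= t)%N -> mdist (iter t TP y) (iter t TP z) = 1 :> R.
  move=> ct; apply: mdist_eq1.
  have fr k : (M <= k)%N -> forall t,
      (iter ((k + tau).+1 + t) TP (late_ghost x N k) 0).2
      = iter t fruit_swap Cherry.
    move=> Mk; apply: fruit_after_ghost; rewrite /late_ghost /= ?p0 ?q0 // => s ks.
    by apply: pM => //; lia.
  have := fr M (leqnn M) (t - c).+1; have := fr M.+1 (leqnSn M) (t - c)%N.
  have -> : ((M.+1 + tau).+1 + (t - c) = t)%N by lia.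
  have -> : ((M + tau).+1 + (t - c).+1 = t)%N by lia.
  by rewrite -/y -/z => ez ey e; apply: (@iter_fruit_swapS (t - c));
    rewrite -ez -ey e.
have e84 : 1 / 8 < 1 / 4 :> R by lra.
have [Ny yP] := lt_of_limn_esup (mx M) e84.
have [Nz zP] := lt_of_limn_esup (mx M.+1) e84.
(* With [n >= c + c], the distances between [y] and [z] sum to at least [n.+1 / 2], while the two
   averages below [1 / 4] bound this sum strictly by [n.+1 / 2]. *)
pose n := maxn (c + c) (maxn Ny Nz).
have := yP n _; have := zP n _; rewrite !leq_max !leqnn !orbT => /(_ isT) + /(_ isT).
rewrite !ltr_pdivrMr ?ltr0Sn // -/y -/z => zn yn.
have : \sum_(t < n.+1) (c <= t)%N%:R <=
    \sum_(t < n.+1) mdist (iter t TP x) (iter t TP y) +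
    \sum_(t < n.+1) mdist (iter t TP x) (iter t TP z) :> R.
  rewrite -big_split /=; apply: ler_sum => t _.
  have [ct|_] := leqP c t; last by rewrite addr_ge0 // mdist_ge0.
  rewrite -(far t ct); apply: le_trans (metric_triangle _ (iter t TP x) _) _.
  by rewrite [mdist (iter t TP y) _]metric_sym.
rewrite -natr_sum.
have cn : (n.+1 <= c + \sum_(t < n.+1) (c <= t))%N.
  elim: n.+1 => [//|k IH]; rewrite big_ord_recr /=.
  have [ck|ck] := leqP c k; first by rewrite /= addn1 addnS ltnS.
  by rewrite addn0 (leq_trans ck) ?leq_addr.
have : (n.+1)%:R <= c%:R + (\sum_(t < n.+1) (c <= t))%N%:R :> R.
  by rewrite -natrD ler_nat.
have : (c + c)%:R <= n.+1%:R :> R by rewrite ler_nat; lia.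
rewrite natrD; lra.
Qed.

Lemma not_almost_mean_equicontinuous : ~ almost_mean_equicontinuous TP.
Proof.
move=> /(residual_meets_cylinder (fun=> (Door, Cherry)) 0)[x [ex cx]].
have x0 : x 0 = (Door, Cherry) by rewrite -cx.
by move: ex; apply: not_mean_equicontinuity_point; rewrite x0.
Qed.

End orbits.

Theorem theorem4p4 (R : realType) :
  ~ mean_sensitive (@pacman_level2 R) /\
  ~ almost_mean_equicontinuous (@pacman_level2 R).
Proof.
by split; [exact: not_mean_sensitive|exact: not_almost_mean_equicontinuous].
Qed.
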